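(* (i) Every matricially normed space is the image of a completely strictly coisometric operator whose domain is an $\widehat M$-composed space. (ii) A matricially normed space is metrically projective if and only if it is a complete direct summand of an $\widehat M$-composed space.
   Context: All linear spaces are complex. $M_n$ is the linear space of $n\times n$ complex matrices, $\|\cdot\|_o$ the operator norm on it. For a linear space $E$, $M_n(E)$ is the space of $n\times n$ matrices with entries in $E$ (identified with $M_n\otimes E$); $u\oplus w$ denotes the block-diagonal matrix with blocks $u,w$. The closed unit ball of a normed space $X$ is $B_X$. A matrix-norm on $E$ is a sequence of norms $\|\cdot\|_n$ on $M_n(E)$, $n\in\mathbb N$, such that (Axiom 1) $\|u\oplus 0\|_{n+m}=\|u\|_n$ for $u\in M_n(E)$ and $0\in M_m(E)$; (Axiom 2) $\|Su\|_n\le\|S\|_o\|u\|_n$ and $\|uS\|_n\le\|u\|_n\|S\|_o$ for $u\in M_n(E)$, $S\in M_n$. A matricially normed space is a linear space with a matrix-norm. A linear subspace $G$ of a matricially normed space $E$, with the norms induced on $M_n(G)\subseteq M_n(E)$, is called a matricially normed subspace. For a linear operator $\varphi:E\to F$, its $m$-th amplification is $\varphi_m:M_m(E)\to M_m(F)$, $(x_{ij})\mapsto(\varphi(x_{ij}))$. An operator between normed spaces $X,Y$ is strictly coisometric if it maps $B_X$ onto $B_Y$. Between matricially normed spaces, $\varphi$ is completely contractive (resp. completely strictly coisometric, a completely isometric isomorphism) if every $\varphi_m$ is contractive (resp. strictly coisometric, an isometric isomorphism). A matricially normed space $P$ is metrically projective if for every completely strictly coisometric operator $\tau:E\to F$ between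 matricially normed spaces and every completely contractive operator $\varphi:P\to F$ there is a completely contractive operator $\psi:P\to E$ with $\tau\psi=\varphi$. The space $\widehat M_n$: for a linear space $E$ and $v=(x_{ij})\in M_n(E)$ let $\varphi^v:M_n\to E$, $(\lambda_{ij})\mapsto\sum_{i,j}\lambda_{ji}x_{ij}$. $\widehat M_n$ is $M_n$ with the matrix-norm given on $u\in M_m(M_n)$ by $\|u\|_m:=\sup\|(\varphi^v)_m(u)\|_m$, the supremum taken over all pairs $(E,v)$ with $E$ a matricially normed space and $v\in B_{M_n(E)}$. Matricial $\ell_1$-sum of a family $E_\nu$, $\nu\in\Lambda$, of matricially normed spaces: the algebraic direct sum $E=\bigoplus_\nu E_\nu$ where, for each $m$, $M_m(E)$ is identified with $\bigoplus_\nu M_m(E_\nu)$ and given the $\ell_1$-sum norm $\|(u_\nu)\|=\sum_\nu\|u_\nu\|_m$ (no completion is taken). A matricially normed space is $\widehat M$-composed if it is a matricial $\ell_1$-sum of some family of spaces each of which is $\widehat M_n$ for some $n\in\mathbb N$ ($n$ may depend on the summand). A matricially normed space $F$ is a complete direct summand of a matricially normed space $E$ if $F$ is completely isometrically isomorphic to a matricially normed subspace $G$ of $E$ and there is a completely contractive projection of $E$ onto $G$. *)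

(* Defs.v *)
(* The complex field is R[i] for an arbitrary R : realType; norms take their
   values in R. *)
From HB Require Import structures.
From mathcomp Require Import all_boot all_order all_algebra.
From mathcomp Require Import finmap.
From mathcomp Require Import complex.
From mathcomp Require Import boolp classical_sets functions cardinality fsbigop.
From mathcomp Require Import reals.

Set Implicit Arguments.
Unset Strict Implicit.
Unset Printing Implicit Defensive.

Import Order.TTheory GRing.Theory Num.Theory Normc.
Local Open Scope classical_set_scope.
Local Open Scope ring_scope.
Local Open Scope complex_scope.

Section OperatorNorm.
Variable R : realType.

Definition l2norm n (x : 'cV[R[i]]_n) : R :=
  Num.sqrt (\sum_i normc (x i 0) ^+ 2).

Definition opnorm n (S : 'M[R[i]]_n) : R :=
  sup [set l2norm (S *m x) | x in [set x : 'cV[R[i]]_n | l2norm x <= 1]].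

Lemma normc_ge0 (a : R[i]) : 0 <= normc a.
Proof. by case: a => a b /=; rewrite sqrtr_ge0. Qed.

Lemma normc_CE (a : R[i]) : (normc a)%:C = `|a|.
Proof. by case: a. Qed.

Lemma l2norm_ge0 n (x : 'cV[R[i]]_n) : 0 <= l2norm x.
Proof. exact: sqrtr_ge0. Qed.

Lemma l2sum_ge0 n (x : 'cV[R[i]]_n) : 0 <= \sum_i normc (x i 0) ^+ 2.
Proof. by apply: sumr_ge0 => i _; apply: sqr_ge0. Qed.

Lemma l2norm_sqr n (x : 'cV[R[i]]_n) :
  l2norm x ^+ 2 = \sum_i normc (x i 0) ^+ 2.
Proof. by rewrite sqr_sqrtr ?l2sum_ge0. Qed.

Lemma l2norm_coord n (x : 'cV[R[i]]_n) i : normc (x i 0) <= l2norm x.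
Proof.
rewrite -(@ler_pXn2r _ 2) ?nnegrE ?normc_ge0 ?l2norm_ge0 // l2norm_sqr.
by rewrite (bigD1 i) //= lerDl; apply: sumr_ge0 => j _; apply: sqr_ge0.
Qed.

Lemma l2norm_eq0 n (x : 'cV[R[i]]_n) : l2norm x = 0 -> x = 0.
Proof.
move=> x0; apply/matrixP => i j; rewrite ord1 mxE; apply: eq0_normc.
by apply/eqP; rewrite eq_le normc_ge0 andbT -x0 l2norm_coord.
Qed.

Lemma l2normZ n a (x : 'cV[R[i]]_n) : l2norm (a *: x) = normc a * l2norm x.
Proof.
apply/eqP; rewrite -(@eqrXn2 _ 2) ?mulr_ge0 ?normc_ge0 ?l2norm_ge0 //.
rewrite exprMn !l2norm_sqr mulr_sumr; apply/eqP/eq_bigr => i _.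
by rewrite mxE normcM exprMn.
Qed.

Lemma l2norm0 n : l2norm (0 : 'cV[R[i]]_n) = 0.
Proof. by rewrite -(scale0r 0) l2normZ normc0 mul0r. Qed.

Lemma l2norm_dot n (x : 'cV[R[i]]_n) :
  sqrtC (dotmx x^T x^T) = (l2norm x)%:C.
Proof.
have -> : dotmx x^T x^T = (l2norm x)%:C ^+ 2.
  rewrite dotmxE -rmorphXn l2norm_sqr /= !mxE rmorph_sum; apply: eq_bigr => i _.
  by rewrite !mxE -normCK rmorphXn /= normc_CE.
by rewrite sqrCK // lecR l2norm_ge0.
Qed.

Lemma ler_l2normD n (x y : 'cV[R[i]]_n) :
  l2norm (x + y) <= l2norm x + l2norm y.
Proof.
rewrite -lecR rmorphD /= -!l2norm_dot linearD /=.
by case: (triangle_lerif (@dotmx R[i] n) x^T y^T).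
Qed.

Lemma l2norm_le_sum n (x : 'cV[R[i]]_n) : l2norm x <= \sum_i normc (x i 0).
Proof.
have h0 : 0 <= \sum_i normc (x i 0) by apply: sumr_ge0 => i _; apply: normc_ge0.
rewrite -(@ler_pXn2r _ 2) ?nnegrE ?l2norm_ge0 // l2norm_sqr.
rewrite [leRHS]expr2 mulr_suml; apply: ler_sum => i _.
rewrite expr2; apply: ler_wpM2l; first exact: normc_ge0.
by rewrite (bigD1 i) //= lerDl; apply: sumr_ge0 => j _; apply: normc_ge0.
Qed.

Lemma opnorm_has_sup n (S : 'M[R[i]]_n) :
  has_sup [set l2norm (S *m x) | x in [set x : 'cV[R[i]]_n | l2norm x <= 1]].
Proof.
split; first by exists (l2norm (S *m 0)); exists 0; rewrite //= l2norm0.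
exists (\sum_i \sum_j normc (S i j)) => _ [x /= x1 <-].
apply: (le_trans (l2norm_le_sum _)); apply: ler_sum => i _; rewrite mxE.
apply: (@le_trans _ _ (\sum_j normc (S i j * x j 0))).
  elim/big_ind2: _ => [|a b c d h1 h2|//]; first by rewrite normc0.
  by apply: (le_trans (le_normcD _ _)); apply: lerD.
apply: ler_sum => j _; rewrite normcM ler_piMr ?normc_ge0 //.
exact: le_trans (l2norm_coord _ _) x1.
Qed.

Lemma opnorm_ge0 n (S : 'M[R[i]]_n) : 0 <= opnorm S.
Proof.
apply: (@le_trans _ _ (l2norm (S *m 0))); first exact: l2norm_ge0.
apply: sup_upper_bound; first exact: opnorm_has_sup.
by exists 0; rewrite //= l2norm0.
Qed.

Lemma ler_opnorm n (S : 'M[R[i]]_n) x : l2norm (S *m x) <= opnorm S * l2norm x.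
Proof.
have [/eqP x0|x0] := boolP (l2norm x == 0).
  by rewrite (l2norm_eq0 x0) mulmx0 l2norm0 mulr0.
have xp : 0 < l2norm x by rewrite lt_def x0 l2norm_ge0.
have nV : normc (l2norm x)^-1%:C = (l2norm x)^-1.
  by rewrite /= expr0n addr0 sqrtr_sqr ger0_norm // invr_ge0 ltW.
rewrite -ler_pdivrMr // mulrC -nV -l2normZ scalemxAr.
apply: sup_upper_bound; first exact: opnorm_has_sup.
by exists ((l2norm x)^-1%:C *: x); rewrite //= l2normZ nV mulVf.
Qed.

Lemma opnorm_le n (S : 'M[R[i]]_n) c :
  (forall x, l2norm x <= 1 -> l2norm (S *m x) <= c) -> opnorm S <= c.
Proof.
move=> h; apply: ge_sup; first by have [] := opnorm_has_sup S.
by move=> _ [x x1 <-]; apply: h.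
Qed.

Lemma opnorm_eq0 n (S : 'M[R[i]]_n) : opnorm S = 0 -> S = 0.
Proof.
move=> S0; apply/matrixP => i j; rewrite mxE.
have : l2norm (S *m delta_mx j 0) = 0.
  by apply/eqP; rewrite eq_le l2norm_ge0 (le_trans (ler_opnorm _ _)) // S0 mul0r.
by move/l2norm_eq0/matrixP/(_ i 0); rewrite -colE !mxE.
Qed.

Lemma ler_opnormD n (S T : 'M[R[i]]_n) : opnorm (S + T) <= opnorm S + opnorm T.
Proof.
apply: opnorm_le => x x1; rewrite mulmxDl (le_trans (ler_l2normD _ _)) //.
by apply: lerD; apply: (le_trans (ler_opnorm _ _)); rewrite ler_piMr ?opnorm_ge0.
Qed.

Lemma opnormZ n a (S : 'M[R[i]]_n) : opnorm (a *: S) = normc a * opnorm S.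
Proof.
have le b (T : 'M[R[i]]_n) : opnorm (b *: T) <= normc b * opnorm T.
  apply: opnorm_le => x x1; rewrite -scalemxAl l2normZ ler_wpM2l ?normc_ge0 //.
  by apply: (le_trans (ler_opnorm _ _)); rewrite ler_piMr ?opnorm_ge0.
apply/eqP; rewrite eq_le le /=.
have [->|a0] := eqVneq a 0; first by rewrite normc0 mul0r opnorm_ge0.
have na : 0 < normc a.
  by rewrite lt_def normc_ge0 andbT; apply: contra_neq a0; apply: eq0_normc.
by rewrite -ler_pdivlMl // -normcV -{1}[S](scalerK a0) le.
Qed.

Lemma ler_opnormM n (S T : 'M[R[i]]_n) : opnorm (S *m T) <= opnorm S * opnorm T.
Proof.
apply: opnorm_le => x x1; rewrite -mulmxA (le_trans (ler_opnorm _ _)) //.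
rewrite ler_wpM2l ?opnorm_ge0 //.
by apply: (le_trans (ler_opnorm _ _)); rewrite ler_piMr ?opnorm_ge0.
Qed.

Lemma opnorm_block n m (S : 'M[R[i]]_n) :
  opnorm (block_mx S 0 0 0 : 'M_(n + m)) = opnorm S.
Proof.
have l2col (a : 'cV[R[i]]_n) (b : 'cV[R[i]]_m) :
    l2norm (col_mx a b) ^+ 2 = l2norm a ^+ 2 + l2norm b ^+ 2.
  rewrite !l2norm_sqr big_split_ord /=.
  by congr (_ + _); apply: eq_bigr => i _; rewrite ?col_mxEu ?col_mxEd.
have l2col0 (a : 'cV[R[i]]_n) : l2norm (col_mx a 0 : 'cV_(n + m)) = l2norm a.
  apply/eqP; rewrite -(@eqrXn2 _ 2) ?l2norm_ge0 // l2col l2norm0.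
  by rewrite expr0n addr0.
have mulE (a : 'cV[R[i]]_n) (b : 'cV[R[i]]_m) :
    (block_mx S 0 0 0 : 'M_(n + m)) *m col_mx a b = col_mx (S *m a) 0.
  by rewrite mul_block_col !mul0mx !addr0.
apply/eqP; rewrite eq_le; apply/andP; split; apply: opnorm_le.
  move=> x; rewrite -[x]vsubmxK mulE l2col0 => x1.
  apply: (le_trans (ler_opnorm _ _)); rewrite ler_piMr ?opnorm_ge0 //.
  apply: le_trans x1; rewrite -(@ler_pXn2r _ 2) ?nnegrE ?l2norm_ge0 //.
  by rewrite l2col lerDl sqr_ge0.
move=> x x1; rewrite -l2col0 -(mulE x 0); apply: (le_trans (ler_opnorm _ _)).
by rewrite ler_piMr ?opnorm_ge0 // l2col0.
Qed.

End OperatorNorm.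

Section ScalarActions.
Variables (R : realType) (E : lmodType R[i]) (n : nat).

Definition lmulmx (S : 'M[R[i]]_n) (u : 'M[E]_n) : 'M[E]_n :=
  \matrix_(i, j) \sum_k S i k *: u k j.

Definition rmulmx (u : 'M[E]_n) (S : 'M[R[i]]_n) : 'M[E]_n :=
  \matrix_(i, j) \sum_k S k j *: u i k.

End ScalarActions.

(* The index n ranges over all of nat.  Since 'M[E]_0 is the zero space, on
   which every norm vanishes, n = 0 adds neither data nor constraints.
   Nonnegativity of mxnorm follows from the axioms (mxnorm_ge0 below). *)
HB.mixin Record isMatNormed (R : realType) E of GRing.Lmodule R[i] E := {
  mxnorm : forall n, 'M[E]_n -> R ;
  mxnorm_eq0 : forall n (u : 'M[E]_n), mxnorm n u = 0 -> u = 0 ;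
  ler_mxnormD : forall n (u v : 'M[E]_n),
    mxnorm n (u + v) <= mxnorm n u + mxnorm n v ;
  mxnormZ : forall n a (u : 'M[E]_n),
    mxnorm n (map_mx (fun x => a *: x) u) = normc a * mxnorm n u ;
  mxnorm_block : forall n m (u : 'M[E]_n),
    mxnorm (n + m)%N (block_mx u 0 0 0) = mxnorm n u ;
  ler_mxnormMl : forall n S (u : 'M[E]_n),
    mxnorm n (lmulmx S u) <= opnorm S * mxnorm n u ;
  ler_mxnormMr : forall n (u : 'M[E]_n) S,
    mxnorm n (rmulmx u S) <= mxnorm n u * opnorm S
}.

#[short(type="matNormedType")]
HB.structure Definition MatNormed (R : realType) :=
  { E of isMatNormed R E & GRing.Lmodule R[i] E }.

Arguments mxnorm {R s n} u.
Arguments mxnorm_eq0 {R s n} u _.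
Arguments ler_mxnormD {R s n} u v.
Arguments mxnormZ {R s n} a u.
Arguments mxnorm_block {R s n} m u.
Arguments ler_mxnormMl {R s n} S u.
Arguments ler_mxnormMr {R s n} u S.

Section MxnormTheory.
Variables (R : realType) (E : matNormedType R).

Lemma mxnorm0 n : mxnorm (0 : 'M[E]_n) = 0.
Proof.
have <- : map_mx (fun x => 0 *: x) (0 : 'M[E]_n) = 0.
  by apply/matrixP => i j; rewrite !mxE scale0r.
by rewrite mxnormZ normc0 mul0r.
Qed.

Lemma mxnorm_ge0 n (u : 'M[E]_n) : 0 <= mxnorm u.
Proof.
have uN : mxnorm (- u) = mxnorm u.
  rewrite -[RHS]mul1r -(normc1 R) -normcN -mxnormZ.
  by congr mxnorm; apply/matrixP => i j; rewrite !mxE scaleN1r.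
have := ler_mxnormD u (- u).
by rewrite subrr mxnorm0 uN -mulr2n pmulrn_lge0.
Qed.

Lemma ler_mxnorm_sum n I (r : seq I) (P : pred I) (F : I -> 'M[E]_n) :
  mxnorm (\sum_(i <- r | P i) F i) <= \sum_(i <- r | P i) mxnorm (F i).
Proof.
elim/big_ind2: _ => [|a b c d h1 h2|//]; first by rewrite mxnorm0.
by apply: (le_trans (ler_mxnormD _ _)); apply: lerD.
Qed.

End MxnormTheory.

Section AmplificationTheory.
Variables (R : realType) (E F : lmodType R[i]) (f : {linear E -> F}).

Lemma amplD n (u v : 'M[E]_n) : map_mx f (u + v) = map_mx f u + map_mx f v.
Proof. by apply/matrixP => i j; rewrite !mxE linearD. Qed.

Lemma ampl0 n m : map_mx f (0 : 'M[E]_(n, m)) = 0.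
Proof. by apply/matrixP => i j; rewrite !mxE linear0. Qed.

Lemma amplZ n a (u : 'M[E]_n) :
  map_mx f (map_mx (fun x => a *: x) u) = map_mx (fun x => a *: x) (map_mx f u).
Proof. by apply/matrixP => i j; rewrite !mxE linearZ. Qed.

Lemma ampl_block n m (u : 'M[E]_n) :
  map_mx f (block_mx u 0 0 0 : 'M_(n + m)) = block_mx (map_mx f u) 0 0 0.
Proof. by rewrite map_block_mx !ampl0. Qed.

Lemma ampl_lmul n S (u : 'M[E]_n) :
  map_mx f (lmulmx S u) = lmulmx S (map_mx f u).
Proof.
apply/matrixP => i j; rewrite !mxE linear_sum; apply: eq_bigr => k _.
by rewrite linearZ !mxE.
Qed.

Lemma ampl_rmul n S (u : 'M[E]_n) :
  map_mx f (rmulmx u S) = rmulmx (map_mx f u) S.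
Proof.
apply/matrixP => i j; rewrite !mxE linear_sum; apply: eq_bigr => k _.
by rewrite linearZ !mxE.
Qed.

End AmplificationTheory.

Section CompleteOperators.
Variables (R : realType) (E F : matNormedType R).

Definition completely_contractive (phi : E -> F) : Prop :=
  forall m (u : 'M[E]_m), mxnorm (map_mx phi u) <= mxnorm u.

Definition completely_strictly_coisometric (phi : E -> F) : Prop :=
  forall m, [set map_mx phi u | u in [set u : 'M[E]_m | mxnorm u <= 1]] =
            [set w : 'M[F]_m | mxnorm w <= 1].

Definition completely_isometric_isomorphism (phi : E -> F) : Prop :=
  forall m, bijective (map_mx phi : 'M[E]_m -> 'M[F]_m) /\
            forall u : 'M[E]_m, mxnorm (map_mx phi u) = mxnorm u.

End CompleteOperators.

Definition metrically_projective (R : realType) (P : matNormedType R) : Prop :=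
  forall (E F : matNormedType R) (tau : {linear E -> F}),
    completely_strictly_coisometric tau ->
  forall phi : {linear P -> F}, completely_contractive phi ->
  exists psi : {linear P -> E},
    completely_contractive psi /\ (forall x, tau (psi x) = phi x).

Section Subspace.
Variables (R : realType) (E : matNormedType R) (G : submodClosed E).

Record subspace := Subspace { subspace_val :> E ; _ : subspace_val \in G }.

HB.instance Definition _ := [isSub for subspace_val].
HB.instance Definition _ := [Choice of subspace by <:].
HB.instance Definition _ := [SubChoice_isSubLmodule of subspace by <:].

Definition subspace_norm n (u : 'M[subspace]_n) : R := mxnorm (map_mx val u).

Let nrm_eq0 n (u : 'M[subspace]_n) : subspace_norm u = 0 -> u = 0.
Proof.
move/mxnorm_eq0/matrixP => u0; apply/matrixP => i j; apply: val_inj.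
by have := u0 i j; rewrite !mxE linear0.
Qed.

Let nrmD n (u v : 'M[subspace]_n) :
  subspace_norm (u + v) <= subspace_norm u + subspace_norm v.
Proof. by rewrite /subspace_norm amplD ler_mxnormD. Qed.

Let nrmZ n a (u : 'M[subspace]_n) :
  subspace_norm (map_mx (fun x => a *: x) u) = normc a * subspace_norm u.
Proof. by rewrite /subspace_norm amplZ mxnormZ. Qed.

Let nrm_block n m (u : 'M[subspace]_n) :
  subspace_norm (block_mx u 0 0 0 : 'M_(n + m)) = subspace_norm u.
Proof. by rewrite /subspace_norm ampl_block mxnorm_block. Qed.

Let nrmMl n S (u : 'M[subspace]_n) :
  subspace_norm (lmulmx S u) <= opnorm S * subspace_norm u.
Proof. by rewrite /subspace_norm ampl_lmul ler_mxnormMl. Qed.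

Let nrmMr n (u : 'M[subspace]_n) S :
  subspace_norm (rmulmx u S) <= subspace_norm u * opnorm S.
Proof. by rewrite /subspace_norm ampl_rmul ler_mxnormMr. Qed.

HB.instance Definition _ := isMatNormed.Build R subspace
  nrm_eq0 nrmD nrmZ nrm_block nrmMl nrmMr.

End Subspace.

Definition complete_direct_summand (R : realType) (F E : matNormedType R) :
    Prop :=
  exists (G : submodClosed E) (iota : {linear F -> subspace G})
         (p : {linear E -> subspace G}),
    [/\ completely_isometric_isomorphism iota,
        completely_contractive p &
        forall x : subspace G, p (val x) = x].

(* The scalar field with the operator norms; its functionals separate the
   points of M_n, which makes the norm of Mhat definite. *)
Section ComplexNumbers.
Variable R : realType.

Let mapZE n a (u : 'M[R[i]^o]_n) : map_mx (fun x => a *: x) u = a *: u.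
Proof. by apply/matrixP => i j; rewrite !mxE. Qed.

Let nrmZ n a (u : 'M[R[i]^o]_n) :
  opnorm (map_mx (fun x => a *: x) u) = normc a * opnorm u.
Proof. by rewrite mapZE opnormZ. Qed.

Let nrmMl n S (u : 'M[R[i]^o]_n) : opnorm (lmulmx S u) <= opnorm S * opnorm u.
Proof.
rewrite (_ : lmulmx S u = S *m u) ?ler_opnormM //.
by apply/matrixP => i j; rewrite !mxE.
Qed.

Let nrmMr n (u : 'M[R[i]^o]_n) S : opnorm (rmulmx u S) <= opnorm u * opnorm S.
Proof.
rewrite (_ : rmulmx u S = u *m S) ?ler_opnormM //.
by apply/matrixP => i j; rewrite !mxE; apply: eq_bigr => k _; apply: mulrC.
Qed.

HB.instance Definition _ := isMatNormed.Build R (R[i]^o)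
  (@opnorm_eq0 R) (@ler_opnormD R) nrmZ (@opnorm_block R) nrmMl nrmMr.

End ComplexNumbers.

Section MatrixUnits.
Variables (R : realType) (E : matNormedType R).

Definition unitmx_at n (a b : 'I_n) (x : E) : 'M[E]_n :=
  \matrix_(k, l) (((k == a) && (l == b))%:R *: x).

Lemma unitmx_at_entry n (a b i j : 'I_n) (w : 'M[E]_n) :
  lmulmx (delta_mx a i) (rmulmx w (delta_mx j b)) = unitmx_at a b (w i j).
Proof.
apply/matrixP => k l; rewrite !mxE (bigD1 i) //= [X in _ + X]big1 => [|p pi].
  rewrite addr0 !mxE eqxx andbT (bigD1 j) //= [X in _ + X]big1 => [|q qj].
    rewrite addr0 !mxE eqxx /= scalerA; congr (_ *: _).
    by rewrite -natrM mulnb.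
  by rewrite !mxE (negPf qj) scale0r.
by rewrite !mxE (negPf pi) andbF scale0r.
Qed.

Lemma mxnorm_unitmx_at n (a b i j : 'I_n) (w : 'M[E]_n) :
  mxnorm (unitmx_at a b (w i j)) <=
  opnorm (delta_mx a i : 'M[R[i]]_n) * (mxnorm w * opnorm (delta_mx j b)).
Proof.
rewrite -unitmx_at_entry; apply: (le_trans (ler_mxnormMl _ _)).
by rewrite ler_wpM2l ?opnorm_ge0 // ler_mxnormMr.
Qed.

Lemma unitmx_at_block m n (a b : 'I_m) (x : E) :
  block_mx (unitmx_at a b x) 0 0 0 = unitmx_at (lshift n a) (lshift n b) x.
Proof.
apply/matrixP => k l; rewrite [RHS]mxE.
case: (split_ordP k) => k' ->; case: (split_ordP l) => l' ->;
  rewrite ?block_mxEul ?block_mxEur ?block_mxEdl ?block_mxEdr mxE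
    ?eq_lshift ?eq_rlshift ?eq_lrshift ?andbF //= ?scale0r //.
Qed.

Lemma mxnorm_cast n m (e : n = m) (w : 'M[E]_n) :
  mxnorm (castmx (e, e) w) = mxnorm w.
Proof. by case: m / e; rewrite castmx_id. Qed.


Lemma unitmx_at0 n (a b : 'I_n) : unitmx_at a b 0 = 0.
Proof. by apply/matrixP => k l; rewrite !mxE scaler0. Qed.

Lemma unitmx_atD n (a b : 'I_n) x y :
  unitmx_at a b (x + y) = unitmx_at a b x + unitmx_at a b y.
Proof. by apply/matrixP => k l; rewrite !mxE scalerDr. Qed.

Lemma mxnorm_unitmx_atZ n (a b : 'I_n) c x :
  mxnorm (unitmx_at a b (c *: x)) = normc c * mxnorm (unitmx_at a b x).
Proof.
rewrite -mxnormZ; congr mxnorm; apply/matrixP => k l.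
by rewrite !mxE !scalerA mulrC.
Qed.

Lemma mxnorm_unitmx_at_sum n (a b : 'I_n) I (r : seq I) (F : I -> E) :
  mxnorm (unitmx_at a b (\sum_(i <- r) F i)) <=
  \sum_(i <- r) mxnorm (unitmx_at a b (F i)).
Proof.
elim/big_rec2: _ => [|i y x _ h]; first by rewrite unitmx_at0 mxnorm0.
by rewrite unitmx_atD (le_trans (ler_mxnormD _ _)) // lerD2l.
Qed.

Lemma unitmx_at_decomp n (w : 'M[E]_n) :
  w = \sum_a \sum_b unitmx_at a b (w a b).
Proof.
apply/matrixP => k l; rewrite summxE (bigD1 k) //= summxE (bigD1 l) //=.
rewrite !big1 => [|p pk|p pl]; rewrite ?mxE ?eqxx ?scale1r ?addr0 //.
  rewrite summxE big1 // => q _.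
  by rewrite mxE eq_sym (negPf pk) scale0r.
by rewrite eq_sym (negPf pl) scale0r.
Qed.

End MatrixUnits.

Definition entry_bound (R : realType) m n (a b : 'I_m) (i j : 'I_n) : R :=
  opnorm (delta_mx (lshift n a) (cast_ord (addnC n m) (lshift m i))
          : 'M[R[i]]_(m + n)) *
  opnorm (delta_mx (cast_ord (addnC n m) (lshift m j)) (lshift n b)
          : 'M[R[i]]_(m + n)).

Lemma ler_entry_bound (R : realType) (E : matNormedType R) m n
    (a b : 'I_m) (i j : 'I_n) (v : 'M[E]_n) :
  mxnorm (unitmx_at a b (v i j)) <= entry_bound R a b i j * mxnorm v.
Proof.
pose w : 'M[E]_(m + n) :=
  castmx (addnC n m, addnC n m) (block_mx v 0 0 0 : 'M_(n + m)).
have -> : v i j = w (cast_ord (addnC n m) (lshift m i))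
                    (cast_ord (addnC n m) (lshift m j)).
  by rewrite castmxE !cast_ordK block_mxEul.
rewrite -(mxnorm_block n) unitmx_at_block (le_trans (mxnorm_unitmx_at _ _ _ _ _)) //.
by rewrite mxnorm_cast mxnorm_block /entry_bound mulrCA mulrC.
Qed.

Section Pairing.
Variables (R : realType) (E : lmodType R[i]) (n : nat) (v : 'M[E]_n).

(* The operator phi^v : M_n -> E.  It pairs the (j, i) entry of l with the
   (i, j) entry of v. *)
Definition mxpairing (l : 'M[R[i]]_n) : E :=
  \sum_i \sum_j l j i *: v i j.

Lemma mxpairing_is_linear : linear mxpairing.
Proof.
move=> a k l; rewrite /mxpairing scaler_sumr -big_split; apply: eq_bigr => i _.
rewrite /= scaler_sumr -big_split; apply: eq_bigr => j _.
by rewrite /= !mxE scalerDl scalerA.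
Qed.

HB.instance Definition _ :=
  GRing.isLinear.Build R[i] 'M[R[i]]_n E *:%R mxpairing mxpairing_is_linear.

End Pairing.

Definition Mhat (R : realType) (n : nat) : Type := 'M[R[i]]_n.

HB.instance Definition _ (R : realType) n := GRing.Lmodule.copy (Mhat R n) 'M[R[i]]_n.

Section Mhat.
Variables (R : realType) (n : nat).

Definition Mhat_values m (u : 'M[Mhat R n]_m) : set R :=
  [set r | exists (E : matNormedType R) (v : 'M[E]_n),
     mxnorm v <= 1 /\ r = mxnorm (map_mx (mxpairing v) u)].

(* A genuine supremum: Mhat_has_sup. *)
Definition Mhat_norm m (u : 'M[Mhat R n]_m) : R := sup (Mhat_values u).

Lemma Mhat_has_sup m (u : 'M[Mhat R n]_m) : has_sup (Mhat_values u).
Proof.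
split.
  exists (mxnorm (map_mx (mxpairing (0 : 'M[R[i]^o]_n)) u)), R[i]^o, 0.
  by rewrite mxnorm0.
exists (\sum_a \sum_b \sum_i \sum_j
          normc ((u a b : 'M[R[i]]_n) j i) * entry_bound R a b i j).
move=> _ [E [v [v1 ->]]]; rewrite [map_mx _ _]unitmx_at_decomp.
apply: (le_trans (ler_mxnorm_sum _ _ _)); apply: ler_sum => a _.
apply: (le_trans (ler_mxnorm_sum _ _ _)); apply: ler_sum => b _.
rewrite mxE /mxpairing.
apply: (le_trans (mxnorm_unitmx_at_sum _ _ _ _)); apply: ler_sum => i _.
apply: (le_trans (mxnorm_unitmx_at_sum _ _ _ _)); apply: ler_sum => j _.
rewrite mxnorm_unitmx_atZ ler_wpM2l ?normc_ge0 //.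
apply: (le_trans (ler_entry_bound _ _ _ _ _)).
by rewrite ler_piMr // /entry_bound mulr_ge0 ?opnorm_ge0.
Qed.

Lemma ler_Mhat_norm m (u : 'M[Mhat R n]_m) (E : matNormedType R) (v : 'M[E]_n) :
  mxnorm v <= 1 -> mxnorm (map_mx (mxpairing v) u) <= Mhat_norm u.
Proof.
by move=> v1; apply: sup_upper_bound; [exact: Mhat_has_sup | exists E, v].
Qed.

Lemma Mhat_norm_le m (u : 'M[Mhat R n]_m) c :
  (forall (E : matNormedType R) (v : 'M[E]_n), mxnorm v <= 1 ->
     mxnorm (map_mx (mxpairing v) u) <= c) -> Mhat_norm u <= c.
Proof.
move=> h; apply: ge_sup; first by have [] := Mhat_has_sup u.
by move=> _ [E [v [v1 ->]]]; apply: h.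
Qed.

Lemma Mhat_norm_ge0 m (u : 'M[Mhat R n]_m) : 0 <= Mhat_norm u.
Proof.
apply: (le_trans (mxnorm_ge0 (map_mx (mxpairing (0 : 'M[R[i]^o]_n)) u))).
by apply: ler_Mhat_norm; rewrite mxnorm0.
Qed.

Lemma Mhat_norm_eq0 m (u : 'M[Mhat R n]_m) : Mhat_norm u = 0 -> u = 0.
Proof.
move=> u0; apply/matrixP => a b; rewrite mxE; apply/matrixP => j i; rewrite mxE.
pose w : 'M[R[i]^o]_n := delta_mx i j.
have [c c0 cw] : exists2 c : R[i], c != 0 & opnorm (c *: w) <= 1.
  have [w0|w0] := eqVneq (opnorm w) 0.
    by exists 1; rewrite ?oner_eq0 // opnormZ w0 mulr0.
  exists (opnorm w)^-1%:C; first by rewrite fmorph_eq0 invr_eq0.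
  by rewrite opnormZ /= expr0n addr0 sqrtr_sqr ger0_norm ?invr_ge0 ?opnorm_ge0 // mulVf.
have /mxnorm_eq0/matrixP/(_ a b) :
    mxnorm (map_mx (mxpairing (c *: w : 'M[R[i]^o]_n)) u) = 0.
  by apply/eqP; rewrite eq_le mxnorm_ge0 -u0 ler_Mhat_norm.
rewrite !mxE /mxpairing (bigD1 i) //= (bigD1 j) //= !big1 => [|p pi|q qj].
- rewrite !addr0 !mxE !eqxx mulr1 => /eqP.
  by rewrite mulf_eq0 (negPf c0) orbF => /eqP.
- by rewrite big1 // => q _; rewrite !mxE (negPf pi) mulr0 scaler0.
- by rewrite !mxE (negPf qj) andbF mulr0 scaler0.
Qed.

Lemma ler_Mhat_normD m (u v : 'M[Mhat R n]_m) :
  Mhat_norm (u + v) <= Mhat_norm u + Mhat_norm v.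
Proof.
apply: Mhat_norm_le => E w w1; rewrite amplD (le_trans (ler_mxnormD _ _)) //.
by apply: lerD; apply: ler_Mhat_norm.
Qed.

Lemma Mhat_normZ m a (u : 'M[Mhat R n]_m) :
  Mhat_norm (map_mx (fun x => a *: x) u) = normc a * Mhat_norm u.
Proof.
apply/eqP; rewrite eq_le; apply/andP; split.
  apply: Mhat_norm_le => E w w1; rewrite amplZ mxnormZ ler_wpM2l ?normc_ge0 //.
  exact: ler_Mhat_norm.
have [->|a0] := eqVneq a 0; first by rewrite normc0 mul0r Mhat_norm_ge0.
have na : 0 < normc a.
  by rewrite lt_def normc_ge0 andbT; apply: contra_neq a0; apply: eq0_normc.
rewrite -ler_pdivlMl //; apply: Mhat_norm_le => E w w1.
by rewrite ler_pdivlMl // -mxnormZ -amplZ ler_Mhat_norm.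
Qed.

Lemma Mhat_norm_block m k (u : 'M[Mhat R n]_m) :
  Mhat_norm (block_mx u 0 0 0 : 'M_(m + k)) = Mhat_norm u.
Proof.
apply/eqP; rewrite eq_le; apply/andP; split; apply: Mhat_norm_le => E w w1.
  by rewrite ampl_block mxnorm_block ler_Mhat_norm.
by rewrite -(mxnorm_block k) -ampl_block ler_Mhat_norm.
Qed.

Lemma ler_Mhat_normMl m S (u : 'M[Mhat R n]_m) :
  Mhat_norm (lmulmx S u) <= opnorm S * Mhat_norm u.
Proof.
apply: Mhat_norm_le => E w w1; rewrite ampl_lmul (le_trans (ler_mxnormMl _ _)) //.
by rewrite ler_wpM2l ?opnorm_ge0 // ler_Mhat_norm.
Qed.

Lemma ler_Mhat_normMr m (u : 'M[Mhat R n]_m) S :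
  Mhat_norm (rmulmx u S) <= Mhat_norm u * opnorm S.
Proof.
apply: Mhat_norm_le => E w w1; rewrite ampl_rmul (le_trans (ler_mxnormMr _ _)) //.
by rewrite ler_wpM2r ?opnorm_ge0 // ler_Mhat_norm.
Qed.

HB.instance Definition _ := isMatNormed.Build R (Mhat R n)
  Mhat_norm_eq0 ler_Mhat_normD Mhat_normZ Mhat_norm_block
  ler_Mhat_normMl ler_Mhat_normMr.

End Mhat.

Section L1Sum.
Variables (R : realType) (L : choiceType) (E : L -> matNormedType R).

(* The algebraic direct sum: finitely supported families. *)
Record l1sum := L1Sum {
  l1comp :> forall nu, E nu ;
  l1supp : finite_set [set nu | l1comp nu != 0]
}.

HB.instance Definition _ := gen_eqMixin l1sum.
HB.instance Definition _ := gen_choiceMixin l1sum.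

Lemma l1sumP (x y : l1sum) : (forall nu, x nu = y nu) -> x = y.
Proof.
case: x y => f fP [g gP] /= fg; have e : f = g by apply: functional_extensionality_dep.
by case: g / e gP {fg} => gP; congr L1Sum; apply: Prop_irrelevance.
Qed.

Let zero_supp : finite_set [set nu | (0 : E nu) != 0].
Proof. by rewrite (_ : mkset _ = set0) // predeqE => nu /=; rewrite eqxx. Qed.

Let opp_supp (x : l1sum) : finite_set [set nu | - x nu != 0].
Proof.
by apply: sub_finite_set (l1supp x) => nu /=; rewrite oppr_eq0.
Qed.

Let add_supp (x y : l1sum) : finite_set [set nu | x nu + y nu != 0].
Proof.
apply: (@sub_finite_set _ _ ([set nu | x nu != 0] `|` [set nu | y nu != 0])).
  move=> nu /= xy; have [x0|] := eqVneq (x nu) 0; last by left.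
  by right; rewrite /= -[y nu]add0r -{1}x0.
by rewrite finite_setU; split; apply: l1supp.
Qed.

Let scale_supp a (x : l1sum) : finite_set [set nu | a *: x nu != 0].
Proof.
apply: sub_finite_set (l1supp x) => nu /=.
by apply: contra_neq => ->; rewrite scaler0.
Qed.

Definition l1zero := L1Sum zero_supp.
Definition l1opp x := L1Sum (opp_supp x).
Definition l1add x y := L1Sum (add_supp x y).
Definition l1scale a x := L1Sum (scale_supp a x).

Let addA : associative l1add.
Proof. by move=> x y z; apply: l1sumP => nu; apply: addrA. Qed.
Let addC : commutative l1add.
Proof. by move=> x y; apply: l1sumP => nu; apply: addrC. Qed.
Let add0 : left_id l1zero l1add.
Proof. by move=> x; apply: l1sumP => nu; apply: add0r. Qed.
Let addN : left_inverse l1zero l1opp l1add.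
Proof. by move=> x; apply: l1sumP => nu; apply: addNr. Qed.

HB.instance Definition _ := GRing.isZmodule.Build l1sum addA addC add0 addN.

Let scaleA a b (x : l1sum) : l1scale a (l1scale b x) = l1scale (a * b) x.
Proof. by apply: l1sumP => nu; apply: scalerA. Qed.
Let scale1 : left_id 1 l1scale.
Proof. by move=> x; apply: l1sumP => nu; apply: scale1r. Qed.
Let scaleDr : right_distributive l1scale +%R.
Proof. by move=> a x y; apply: l1sumP => nu; apply: scalerDr. Qed.
Let scaleDl (x : l1sum) : {morph l1scale^~ x : a b / a + b}.
Proof. by move=> a b; apply: l1sumP => nu; apply: scalerDl. Qed.

HB.instance Definition _ :=
  GRing.Zmodule_isLmodule.Build R[i] l1sum scaleA scale1 scaleDr scaleDl.

Definition l1proj nu (x : l1sum) : E nu := x nu.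

Lemma l1proj_is_linear nu : linear (l1proj nu).
Proof. by []. Qed.

HB.instance Definition _ nu :=
  GRing.isLinear.Build R[i] l1sum (E nu) *:%R (l1proj nu) (l1proj_is_linear nu).

(* The matrix u corresponds to the family of its images under the amplified
   coordinate projections; all but finitely many terms of the sum vanish
   (l1sum_mxsupp). *)
Definition l1sum_norm n (u : 'M[l1sum]_n) : R :=
  \sum_(nu \in [set: L]) mxnorm (map_mx (l1proj nu) u).

Lemma l1sum_mxsupp n (u : 'M[l1sum]_n) :
  exists A : {fset L}, forall nu, nu \notin A -> map_mx (l1proj nu) u = 0.
Proof.
have /finite_fsetP[A AE] : finite_set
    (\bigcup_(ij in [set: 'I_n * 'I_n]) [set nu | u ij.1 ij.2 nu != 0]).
  by apply: bigcup_finite => // ij _; apply: l1supp.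
exists A => nu nuA; apply/matrixP => i j; rewrite !mxE.
apply: contraNeq nuA => unu.
have : [set` A] nu by rewrite -AE; exists (i, j).
by [].
Qed.

Lemma l1sum_normE n (u : 'M[l1sum]_n) (A : {fset L}) :
  (forall nu, nu \notin A -> map_mx (l1proj nu) u = 0) ->
  l1sum_norm u = \sum_(nu <- A) mxnorm (map_mx (l1proj nu) u).
Proof.
by move=> h; apply: fsbigTE => nu /h ->; rewrite mxnorm0.
Qed.

Lemma l1sum_norm_eq0 n (u : 'M[l1sum]_n) : l1sum_norm u = 0 -> u = 0.
Proof.
have [A hA] := l1sum_mxsupp u; rewrite (l1sum_normE hA) => /eqP.
rewrite psumr_eq0 => [/allP h|nu _]; last exact: mxnorm_ge0.
apply/matrixP => i j; apply: l1sumP => nu.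
suff /matrixP/(_ i j) : map_mx (l1proj nu) u = 0 by rewrite !mxE.
have [/h/eqP/mxnorm_eq0//|/hA//] := boolP (nu \in A).
Qed.

Lemma ler_l1sum_normD n (u v : 'M[l1sum]_n) :
  l1sum_norm (u + v) <= l1sum_norm u + l1sum_norm v.
Proof.
have [A hA] := l1sum_mxsupp u; have [B hB] := l1sum_mxsupp v.
rewrite !(@l1sum_normE _ _ (A `|` B)%fset).
- rewrite -big_split; apply: ler_sum => nu _.
  by rewrite amplD ler_mxnormD.
- by move=> nu; rewrite inE negb_or => /andP[_ /hB].
- by move=> nu; rewrite inE negb_or => /andP[/hA].
- by move=> nu; rewrite inE negb_or amplD => /andP[/hA -> /hB ->]; rewrite addr0.
Qed.

Lemma l1sum_normZ n a (u : 'M[l1sum]_n) :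
  l1sum_norm (map_mx (fun x => a *: x) u) = normc a * l1sum_norm u.
Proof.
have [A hA] := l1sum_mxsupp u; rewrite !(@l1sum_normE _ _ A) //.
  by rewrite mulr_sumr; apply: eq_bigr => nu _; rewrite amplZ mxnormZ.
move=> nu /hA; rewrite amplZ => ->; apply/matrixP => i j.
by rewrite !mxE scaler0.
Qed.

Lemma l1sum_norm_block n m (u : 'M[l1sum]_n) :
  l1sum_norm (block_mx u 0 0 0 : 'M_(n + m)) = l1sum_norm u.
Proof.
by apply: eq_fsbigr => nu _; rewrite ampl_block mxnorm_block.
Qed.

Lemma ler_l1sum_normMl n S (u : 'M[l1sum]_n) :
  l1sum_norm (lmulmx S u) <= opnorm S * l1sum_norm u.
Proof.
have [A hA] := l1sum_mxsupp u; rewrite !(@l1sum_normE _ _ A) //.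
  by rewrite mulr_sumr; apply: ler_sum => nu _; rewrite ampl_lmul ler_mxnormMl.
move=> nu /hA; rewrite ampl_lmul => ->; apply/matrixP => i j.
by rewrite !mxE big1 // => k _; rewrite mxE scaler0.
Qed.

Lemma ler_l1sum_normMr n (u : 'M[l1sum]_n) S :
  l1sum_norm (rmulmx u S) <= l1sum_norm u * opnorm S.
Proof.
have [A hA] := l1sum_mxsupp u; rewrite !(@l1sum_normE _ _ A) //.
  by rewrite mulr_suml; apply: ler_sum => nu _; rewrite ampl_rmul ler_mxnormMr.
move=> nu /hA; rewrite ampl_rmul => ->; apply/matrixP => i j.
by rewrite !mxE big1 // => k _; rewrite mxE scaler0.
Qed.

HB.instance Definition _ := isMatNormed.Build R l1sum
  l1sum_norm_eq0 ler_l1sum_normD l1sum_normZ l1sum_norm_block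
  ler_l1sum_normMl ler_l1sum_normMr.

End L1Sum.

(* A family over an arbitrary index type is covered, since every type has a
   choiceType structure (gen_choiceMixin). *)
Definition Mhat_composed (R : realType) (E : matNormedType R) : Prop :=
  exists (L : choiceType) (n : L -> nat),
    (forall nu, (0 < n nu)%N) /\
    E = l1sum (fun nu => Mhat R (n nu)).

(* Main.v *)
(** The space Mhat_n corepresents the unit ball of M_n: completely contractive
    operators from Mhat_n to E correspond to elements v of that ball by
    [v = phi_n(e)], where e is the matrix of matrix units (transposed, so that
    it matches the pairing).  Since completely strictly coisometric operators
    lift such elements, Mhat_n is metrically projective.  Completely contractive
    operators out of a matricial l1-sum are families of completely contractive
    operators out of the summands, so every Mhat-composed space is metrically
    projective, and so are its complete direct summands.  The sum of the copies
    of Mhat_n over all n and all elements of the unit ball of M_n(F) covers F;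
    for metrically projective F the identity of F lifts through this covering. *)
Require Import Defs.
From HB Require Import structures.
From mathcomp Require Import all_boot all_order all_algebra.
From mathcomp Require Import finmap.
From mathcomp Require Import complex.
From mathcomp Require Import boolp classical_sets cardinality fsbigop.
From mathcomp Require Import reals.

Set Implicit Arguments.
Unset Strict Implicit.
Unset Printing Implicit Defensive.

Import Order.TTheory GRing.Theory Num.Theory Normc.
Local Open Scope classical_set_scope.
Local Open Scope ring_scope.

(** * Completely contractive and completely strictly coisometric operators *)

Lemma completely_contractive_comp (R : realType) (E F G : matNormedType R)
    (f : F -> G) (g : E -> F) :
  completely_contractive f -> completely_contractive g ->
  completely_contractive (f \o g).
Proof. by move=> f1 g1 m u; rewrite map_mx_comp (le_trans (f1 _ _)). Qed.

Section Coisometric.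
Variables (R : realType) (E F : matNormedType R) (tau : {linear E -> F}).

Lemma coisometric_lift m (w : 'M[F]_m) :
  completely_strictly_coisometric tau -> mxnorm w <= 1 ->
  exists2 u : 'M[E]_m, mxnorm u <= 1 & map_mx tau u = w.
Proof.
move=> tauP w1; suff [u u1 uw] : [set map_mx tau u | u in
    [set u : 'M[E]_m | mxnorm u <= 1]] w by exists u.
by rewrite tauP.
Qed.

(** Coisometry speaks of unit balls only. A nonzero matrix is scaled to norm 1, and homogeneity
    carries the bound back. *)
Lemma completely_contractive_ball :
  (forall m (u : 'M[E]_m), mxnorm u <= 1 -> mxnorm (map_mx tau u) <= 1) ->
  completely_contractive tau.
Proof.
move=> tau1 m u; have [u0|u0] := eqVneq (mxnorm u) 0.
  by rewrite (mxnorm_eq0 u u0) ampl0 !mxnorm0.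
have up : 0 < mxnorm u by rewrite lt_def u0 mxnorm_ge0.
have nV : normc ((mxnorm u)^-1)%:C%C = (mxnorm u)^-1.
  by rewrite /= expr0n addr0 sqrtr_sqr ger0_norm // invr_ge0 ltW.
have := tau1 m (map_mx (fun x => ((mxnorm u)^-1)%:C%C *: x) u).
rewrite amplZ !mxnormZ nV mulVf // => /(_ (lexx _)).
by rewrite mulrC ler_pdivrMr // mul1r.
Qed.

Lemma coisometric_contractive :
  completely_strictly_coisometric tau -> completely_contractive tau.
Proof.
move=> tauP; apply: completely_contractive_ball => m u u1.
suff : [set w : 'M[F]_m | mxnorm w <= 1] (map_mx tau u) by [].
by rewrite -tauP; exists u.
Qed.

End Coisometric.

(** * Universal property of [Mhat] *)

Section MhatUniversal.
Variables (R : realType) (n : nat).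

Definition mxunits : 'M[Mhat R n]_n :=
  \matrix_(i, j) (delta_mx j i : 'M[R[i]]_n).

Lemma mxpairing_units (E : lmodType R[i]) (v : 'M[E]_n) :
  map_mx (mxpairing v) mxunits = v.
Proof.
apply/matrixP => i j; rewrite !mxE /mxpairing (bigD1 i) //= (bigD1 j) //= !big1.
- by rewrite !addr0 mxE !eqxx scale1r.
- move=> p pi; rewrite big1 // => q _.
  by rewrite mxE (negPf pi) andbF scale0r.
- by move=> q qj; rewrite mxE (negPf qj) scale0r.
Qed.

(** Pairing with [v] sends [mxunits] to [v], so the supremum defining this norm runs over norms of
    elements of unit balls. *)
Lemma mxnorm_units : mxnorm mxunits <= 1.
Proof. by apply: Mhat_norm_le => E v v1; rewrite mxpairing_units. Qed.

(** The entries of [mxunits] span, so a linear map is determined by its amplification at [mxunits],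
    and there the two sides agree. *)
Lemma mxpairing_ampl_units (E : lmodType R[i]) (f : {linear Mhat R n -> E}) x :
  f x = mxpairing (map_mx f mxunits) x.
Proof.
have -> : x = \sum_i \sum_j (x : 'M[R[i]]_n) j i *: mxunits i j :> Mhat R n.
  rewrite {1}(matrix_sum_delta (x : 'M[R[i]]_n)) exchange_big.
  by apply: eq_bigr => i _; apply: eq_bigr => j _; rewrite mxE.
have lin (g h : {linear Mhat R n -> E}) : map_mx g mxunits = map_mx h mxunits ->
  forall y : 'M_n, g (\sum_i \sum_j y j i *: mxunits i j) =
                   h (\sum_i \sum_j y j i *: mxunits i j).
  move=> gh y; rewrite !linear_sum; apply: eq_bigr => i _.
  rewrite !linear_sum; apply: eq_bigr => j _; rewrite !linearZ /=.
  by move/matrixP/(_ i j): gh; rewrite !mxE => ->.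
exact: (lin f (mxpairing (map_mx f mxunits))) (esym (mxpairing_units _)) x.
Qed.

Lemma mxpairing_contractive (E : matNormedType R) (v : 'M[E]_n) :
  mxnorm v <= 1 ->
  completely_contractive (mxpairing v : Mhat R n -> E).
Proof. by move=> v1 m u; apply: ler_Mhat_norm. Qed.

Lemma Mhat_projective : metrically_projective (Mhat R n).
Proof.
move=> E F tau tauP phi phi1.
(* [map_mx phi mxunits] lies in the unit ball, hence comes from some [v] in the unit ball over [E];
   the pairing with [v] lifts [phi]. *)
have [v v1 vE] := coisometric_lift tauP (le_trans (phi1 _ _) mxnorm_units).
exists (mxpairing v : {linear Mhat R n -> E}); split.
  exact: mxpairing_contractive.
move=> x; rewrite [RHS]mxpairing_ampl_units -vE /mxpairing.
rewrite linear_sum; apply: eq_bigr => i _.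
rewrite linear_sum; apply: eq_bigr => j _.
by rewrite linearZ [map_mx tau v i j]mxE.
Qed.

End MhatUniversal.

(** * Universal property of the matricial l1-sum *)

Section L1SumUniversal.
Variables (R : realType) (L : choiceType) (E : L -> matNormedType R).

Lemma l1sum_supp (x : l1sum E) :
  exists A : {fset L}, forall nu, nu \notin A -> x nu = 0.
Proof.
have [A hA] := l1sum_mxsupp (const_mx x : 'M_1); exists A => nu /hA.
by move/matrixP/(_ 0 0); rewrite !mxE.
Qed.

Section Injection.
Variable mu : L.

(** The summands have different types, so [x] is transported along the proof of [mu = nu] that
    [eqVneq] supplies. *)
Definition l1in_fun (x : E mu) (nu : L) : E nu :=
  if eqVneq mu nu is EqNotNeq e then ecast nu (E nu) e x else 0.

Lemma l1in_fun_id x : l1in_fun x mu = x.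
Proof.
rewrite /l1in_fun; case: eqVneq => [e|/eqP//].
(* Equality proofs on [L] are unique, so this transport is trivial. *)
by rewrite (eq_axiomK e).
Qed.

Lemma l1in_fun_neq x nu : mu != nu -> l1in_fun x nu = 0.
Proof. by rewrite /l1in_fun; case: eqVneq. Qed.

Lemma l1in_supp x : finite_set [set nu | l1in_fun x nu != 0].
Proof.
apply: (sub_finite_set _ (finite_set1 mu)) => nu /=.
by have [->//|/l1in_fun_neq ->] := eqVneq mu nu; rewrite eqxx.
Qed.

Definition l1in x : l1sum E := L1Sum (l1in_supp x).

Lemma l1in_id x : l1in x mu = x.
Proof. exact: l1in_fun_id. Qed.

Lemma l1in_neq x nu : mu != nu -> l1in x nu = 0.
Proof. exact: l1in_fun_neq. Qed.

Lemma l1in_is_linear : linear l1in.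
Proof.
move=> a x y; apply: l1sumP => nu.
rewrite [RHS](_ : _ = a *: l1in x nu + l1in y nu) //.
have [<-|ne] := eqVneq mu nu; first by rewrite !l1in_id.
by rewrite !l1in_neq // scaler0 addr0.
Qed.

HB.instance Definition _ :=
  GRing.isLinear.Build R[i] (E mu) (l1sum E) *:%R l1in l1in_is_linear.

Lemma mxnorm_l1in m (u : 'M[E mu]_m) : mxnorm (map_mx l1in u) = mxnorm u.
Proof.
rewrite [LHS](@l1sum_normE _ _ _ _ _ [fset mu]%fset) => [|nu].
  rewrite big_seq_fset1; congr mxnorm; apply/matrixP => i j.
  by rewrite !mxE; apply: l1in_id.
rewrite inE eq_sym => ne; apply/matrixP => i j.
by rewrite !mxE; apply: l1in_neq.
Qed.

End Injection.

Lemma l1sum_decomp (x : l1sum E) (A : {fset L}) :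
  (forall nu, nu \notin A -> x nu = 0) -> x = \sum_(nu <- A) l1in (x nu).
Proof.
move=> hA; apply: l1sumP => mu.
rewrite -[RHS]/(l1proj mu _) linear_sum /=.
have [muA|muA] := boolP (mu \in A).
  rewrite (bigD1_seq mu) ?fset_uniq // big1 /= => [|nu ne]; last exact: l1in_neq.
  by rewrite addr0; apply/esym/l1in_id.
rewrite (hA _ muA) big_seq big1 // => nu nuA; apply: l1in_neq.
by apply: contraNneq muA => <-.
Qed.

Section Copairing.
Variables (F : matNormedType R) (f : forall nu, {linear E nu -> F}).

Definition l1copair (x : l1sum E) : F := \sum_(nu \in [set: L]) f nu (x nu).

(** [A] may exceed the support, so several elements can be treated over one common index set. *)
Lemma l1copairE (x : l1sum E) (A : {fset L}) :
  (forall nu, nu \notin A -> x nu = 0) ->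
  l1copair x = \sum_(nu <- A) f nu (x nu).
Proof. by move=> h; apply: fsbigTE => nu /h ->; rewrite linear0. Qed.

Lemma l1copair_is_linear : linear l1copair.
Proof.
move=> a x y; have [A hA] := l1sum_supp x; have [B hB] := l1sum_supp y.
rewrite !(@l1copairE _ (A `|` B)%fset).
- rewrite scaler_sumr -big_split; apply: eq_bigr => nu _ /=.
  by rewrite -linearP.
- by move=> nu; rewrite inE negb_or => /andP[_ /hB].
- by move=> nu; rewrite inE negb_or => /andP[/hA].
- move=> nu; rewrite inE negb_or => /andP[/hA xnu /hB ynu].
  by rewrite [LHS](_ : _ = a *: x nu + y nu) // xnu ynu scaler0 addr0.
Qed.

HB.instance Definition _ :=
  GRing.isLinear.Build R[i] (l1sum E) F *:%R l1copair l1copair_is_linear.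

Lemma l1copair_in mu (x : E mu) : l1copair (l1in x) = f mu x.
Proof.
rewrite (@l1copairE _ [fset mu]%fset) ?big_seq_fset1 ?l1in_id // => nu.
by rewrite inE eq_sym => /l1in_neq.
Qed.

(** The triangle inequality over finitely many indices produces exactly the l1-sum of the norms of
    the components. *)
Lemma l1copair_contractive :
  (forall nu, completely_contractive (f nu)) -> completely_contractive l1copair.
Proof.
move=> f1 m u; have [A hA] := l1sum_mxsupp u.
rewrite [leRHS](l1sum_normE hA).
have -> : map_mx l1copair u = \sum_(nu <- A) map_mx (f nu) (map_mx (l1proj nu) u).
  apply/matrixP => i j; rewrite summxE mxE (@l1copairE _ A).
    by apply: eq_bigr => nu _; rewrite !mxE.
  by move=> nu /hA/matrixP/(_ i j); rewrite !mxE.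
by apply: (le_trans (ler_mxnorm_sum _ _ _)); apply: ler_sum => nu _; apply: f1.
Qed.

End Copairing.

(** Composed with the isometric [l1in], [phi] stays contractive and lifts on each summand; the
    chosen lifts are glued by [l1copair]. *)
Lemma l1sum_projective :
  (forall nu, metrically_projective (E nu)) -> metrically_projective (l1sum E).
Proof.
move=> projE X Y tau tauP phi phi1.
have lift nu : exists psi : {linear E nu -> X},
    completely_contractive psi /\ (forall x, tau (psi x) = phi (l1in x)).
  apply: (projE nu _ _ _ tauP (phi \o @l1in nu)) => m u.
  by rewrite map_mx_comp (le_trans (phi1 _ _)) // mxnorm_l1in.
pose psi nu := projT1 (cid (lift nu)); have psiP nu := projT2 (cid (lift nu)).
exists (l1copair psi); split.
  by apply: l1copair_contractive => nu; have [] := psiP nu.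
move=> x; have [A hA] := l1sum_supp x.
rewrite /= (l1copairE _ hA) [in RHS](l1sum_decomp hA) !linear_sum.
by apply: eq_bigr => nu _; have [_ ->] := psiP nu.
Qed.

End L1SumUniversal.

Lemma Mhat_composed_projective (R : realType) (E : matNormedType R) :
  Mhat_composed E -> metrically_projective E.
Proof.
move=> [L [n [_ ->]]]; apply: l1sum_projective => nu; exact: Mhat_projective.
Qed.

(** * The canonical covering by an Mhat-composed space *)

Section Cover.
Variables (R : realType) (F : matNormedType R).

(** The size is [k.+1] because summands of an Mhat-composed space have positive size. *)
Definition cover_index : Type :=
  {k : nat & {v : 'M[F]_k.+1 | mxnorm v <= 1}}.

HB.instance Definition _ := gen_eqMixin cover_index.
HB.instance Definition _ := gen_choiceMixin cover_index.

Definition cover : matNormedType R :=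
  l1sum (fun nu : cover_index => Mhat R (projT1 nu).+1).

Definition cover_map : {linear cover -> F} :=
  l1copair (fun nu : cover_index =>
    mxpairing (projT1 (projT2 nu)) : {linear Mhat R (projT1 nu).+1 -> F}).

Lemma cover_composed : Mhat_composed cover.
Proof. by exists cover_index, (fun nu => (projT1 nu).+1). Qed.

Lemma cover_map_coisometric : completely_strictly_coisometric cover_map.
Proof.
move=> m; apply/seteqP; split => [_ [u u1 <-]|w w1] /=.
  apply: le_trans u1; apply: l1copair_contractive => -[k [v v1]].
  exact: mxpairing_contractive.
(* Size 0 has no index, but there 0 is the only matrix. *)
case: m w w1 => [|k] w w1.
  by exists 0; [rewrite /= mxnorm0 | apply/matrixP => -[]].
(* [w] is itself an index, and the matrix units of its summand are mapped to it. *)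
pose nu : cover_index := existT _ k (exist _ w w1).
exists (map_mx (@l1in _ _ (fun nu : cover_index => Mhat R (projT1 nu).+1) nu)
               (mxunits R k.+1)).
  by rewrite /= mxnorm_l1in mxnorm_units.
rewrite -[RHS](mxpairing_units w); apply/matrixP => i j.
by rewrite !mxE /= l1copair_in.
Qed.

End Cover.

(** * Projectivity passes to complete direct summands *)

Section Retract.
Variables (R : realType) (P E : matNormedType R).

(** [phi] is extended to [E] through [p] and the inverse of [iota], lifted there, and restricted
    back along [iota]. *)
Lemma summand_projective :
  complete_direct_summand P E -> metrically_projective E ->
  metrically_projective P.
Proof.
move=> [G [iota [p [iotaP p1 pK]]]] projE X Y tau tauP phi phi1.
(* Bijectivity is given for amplifications; size 1 yields an inverse [h] of [iota] itself. *)
have [[g gK Kg] _] := iotaP 1%N.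
pose h (y : subspace G) : P := g (const_mx y) 0 0.
have iotaK : cancel iota h.
  by move=> x; rewrite /h -map_const_mx gK mxE.
have hK : cancel h iota.
  by move=> y; have /matrixP/(_ 0 0) := Kg (const_mx y); rewrite !mxE.
have h_lin : linear h.
  by move=> a x y; apply: (can_inj iotaK); rewrite linearP !hK.
pose hL : {linear subspace G -> P} := HB.pack h
  (GRing.isLinear.Build R[i] (subspace G) P *:%R h h_lin).
have h1 : completely_contractive hL.
  move=> m u; rewrite -[leLHS](proj2 (iotaP m)) -map_mx_comp.
  by rewrite (eq_map_mx _ hK) map_mx_id.
have iota1 : completely_contractive (val \o iota).
  by move=> m u; rewrite map_mx_comp -(proj2 (iotaP m) u).
have [psi [psi1 psiP]] := projE _ _ _ tauP (phi \o (hL \o p))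
  (completely_contractive_comp phi1 (completely_contractive_comp h1 p1)).
exists (psi \o (val \o iota)); split => [|x] /=.
  exact: completely_contractive_comp psi1 iota1.
by rewrite psiP /= pK iotaK.
Qed.

End Retract.

(** * A contractive section yields a complete direct summand *)

Section Splitting.
Variables (R : realType) (P E : matNormedType R).
Variables (tau : {linear E -> P}) (psi : {linear P -> E}).

(** Once [tau \o psi] is the identity, this is the range of [psi]. *)
Definition section_range : {pred E} := [pred x | psi (tau x) == x].

Lemma section_range_submod : submod_closed section_range.
Proof.
split => [|a x y]; rewrite !inE ?linear0 // => /eqP xE /eqP yE.
by rewrite !linearP xE yE.
Qed.

HB.instance Definition _ := GRing.isSubmodClosed.Build R[i] E section_range
  section_range_submod.

Hypotheses (tau1 : completely_contractive tau).
Hypotheses (psi1 : completely_contractive psi) (psiK : forall x, tau (psi x) = x).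

Let section_rangeP x : psi x \in section_range.
Proof. by rewrite inE psiK. Qed.

Let into x : subspace section_range := Subspace (section_rangeP x).

Let into_linear : linear into.
Proof. by move=> a x y; apply: val_inj; rewrite /= linearP. Qed.

HB.instance Definition _ :=
  GRing.isLinear.Build R[i] P (subspace section_range) *:%R into into_linear.

(** [into] is isometric because [psi] and its left inverse [tau] are both contractive; [into \o tau]
    is the projection. *)
Lemma section_summand : complete_direct_summand P E.
Proof.
have norm_into m (u : 'M[P]_m) : mxnorm (map_mx into u) = mxnorm (map_mx psi u).
  by rewrite [LHS]/mxnorm /= /subspace_norm -map_mx_comp.
exists (section_range : submodClosed E), into, (into \o tau); split.
- move=> m; split=> [|u].
    exists (map_mx (tau \o val)) => u; apply/matrixP => i j; rewrite !mxE /=.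
      exact: psiK.
    by apply: val_inj; apply/eqP; exact: (valP (u i j)).
  apply/eqP; rewrite norm_into eq_le psi1 /=.
  by apply: le_trans (tau1 _); rewrite -map_mx_comp (eq_map_mx _ psiK) map_mx_id.
- move=> m u; apply: le_trans (tau1 u); rewrite map_mx_comp norm_into.
  exact: psi1.
- by move=> x; apply: val_inj; apply/eqP; exact: (valP x).
Qed.

End Splitting.

Theorem theorem5 (R : realType) :
  (forall F : matNormedType R,
     exists E : matNormedType R, Mhat_composed E /\
       exists tau : {linear E -> F}, completely_strictly_coisometric tau) /\
  (forall P : matNormedType R,
     metrically_projective P <->
     exists E : matNormedType R, Mhat_composed E /\ complete_direct_summand P E).
Proof.
split=> [F|P].
  exists (cover F); split; first exact: cover_composed.
  by exists (cover_map F); apply: cover_map_coisometric.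
split=> [projP|[E [Ecomp PE]]].
  have tauP := @cover_map_coisometric R P.
  have [|psi [psi1 psiK]] := projP _ _ _ tauP idfun.
    by move=> m u; rewrite map_mx_id.
  exists (cover P); split; first exact: cover_composed.
  exact: section_summand (coisometric_contractive tauP) psi1 psiK.
exact: summand_projective PE (Mhat_composed_projective Ecomp).
Qed.
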